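(* Let $n$ be a positive integer, and let $H_k(\cdot,n)$ and $K_k(\cdot,n)$ be the difference hyperbolic and difference trigonometric functions of order $n$, extended to indices $k\in\{0,-1,\dots,-(n-1)\}$ as in the context. Then for all integers $m,s\ge 0$ and all $i\in\{1,\dots,n\}$, $$H_i(m+s,n)=\sum_{j=1}^{n}H_j(s,n)\,H_{i-j+1}(m,n)$$ and $$K_i(m+s,n)=\sum_{j=1}^{n}K_j(s,n)\,K_{i-j+1}(m,n).$$
   Context: For a function $f$ of a nonnegative integer variable $m$, set $\Delta f(m)=f(m+1)-f(m)$. Fix a positive integer $n$. The difference hyperbolic functions of order $n$, $H_1(m,n),\dots,H_n(m,n)$ (with $m$ a nonnegative integer variable), are the functions $y_s(m)=H_s(m,n)$ forming the solution of the system of difference equations $$\Delta y_s(m)=y_{s-1}(m),\quad s=2,3,\dots,n,\qquad \Delta y_1(m)=y_n(m),$$ with initial values $y_1(0)=1$ and $y_s(0)=0$ for $s=2,\dots,n$. The difference trigonometric functions of order $n$, $K_1(m,n),\dots,K_n(m,n)$ (with $m$ a nonnegative integer variable), are the functions $y_s(m)=K_s(m,n)$ forming the solution of the system of difference equations $$\Delta y_s(m)=y_{s-1}(m),\quad s=2,3,\dots,n,\qquad \Delta y_1(m)=-y_n(m),$$ with initial values $y_1(0)=1$ and $y_s(0)=0$ for $s=2,\dots,n$. The index is extended to $0,-1,\dots,-(n-1)$ by setting, for $s=1,\dots,n$, $$H_{-(s-1)}(m,n)=H_{n-s+1}(m,n),\qquad K_{-(s-1)}(m,n)=-K_{n-s+1}(m,n).$$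 *)

(* Defs.v *)
From HB Require Import structures.
From mathcomp Require Import all_boot all_order all_algebra.
Set Implicit Arguments.
Unset Strict Implicit.
Unset Printing Implicit Defensive.
Import Order.TTheory GRing.Theory Num.Theory.
Local Open Scope ring_scope.

(* A family y_1, ..., y_n of functions of a
   nonnegative integer variable is y : nat -> nat -> R, with y s m = y_s(m);
   only the indices 1 <= s <= n are meaningful.  The two systems have integer
   coefficients and initial values, so they make sense over any commutative
   ring R, in particular over the real and the complex numbers. *)

Definition fdiff (R : comNzRingType) (f : nat -> R) (m : nat) : R :=
  f m.+1 - f m.

Lemma fdiffP (R : comNzRingType) (f : nat -> R) (m : nat) (a : R) :
  fdiff f m = a <-> f m.+1 = f m + a.
Proof. by rewrite /fdiff; split=> [<-|->]; rewrite addrC ?subrK ?addKr. Qed.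

Definition diff_hyperbolic (R : comNzRingType) (n : nat)
    (y : nat -> nat -> R) : Prop :=
  [/\ forall s m : nat, (2 <= s <= n)%N -> fdiff (y s) m = y s.-1 m,
      forall m : nat, fdiff (y 1%N) m = y n m,
      y 1%N 0%N = 1
    & forall s : nat, (2 <= s <= n)%N -> y s 0%N = 0].

Definition diff_trigonometric (R : comNzRingType) (n : nat)
    (y : nat -> nat -> R) : Prop :=
  [/\ forall s m : nat, (2 <= s <= n)%N -> fdiff (y s) m = y s.-1 m,
      forall m : nat, fdiff (y 1%N) m = - y n m,
      y 1%N 0%N = 1
    & forall s : nat, (2 <= s <= n)%N -> y s 0%N = 0].

(* Extension to the indices 0, -1, ..., -(n-1): for k = -(s-1) with
   1 <= s <= n, the index n - s + 1 is n - `|k|.  Outside -(n-1) <= k <= n the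
   values carry no meaning. *)
Definition hyp_ext (R : comNzRingType) (n : nat) (y : nat -> nat -> R)
    (k : int) (m : nat) : R :=
  if 0 < k then y `|k|%N m else y (n - `|k|)%N m.

Definition trig_ext (R : comNzRingType) (n : nat) (y : nat -> nat -> R)
    (k : int) (m : nat) : R :=
  if 0 < k then y `|k|%N m else - y (n - `|k|)%N m.

Lemma hyp_ext_pos (R : comNzRingType) (n : nat) (y : nat -> nat -> R) s m :
  (0 < s)%N -> hyp_ext n y s%:Z m = y s m.
Proof. by case: s. Qed.

Lemma hyp_ext_neg (R : comNzRingType) (n : nat) (y : nat -> nat -> R) s m :
  (1 <= s <= n)%N -> hyp_ext n y (- (s%:Z - 1)) m = y (n - s + 1)%N m.
Proof.
case: s => // s /andP[_ lesn].
have -> : s.+1%:Z - 1 = s%:Z by rewrite intS addrC addKr.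
by rewrite /hyp_ext oppr_gt0 abszN addn1 subnSK.
Qed.

Lemma trig_ext_pos (R : comNzRingType) (n : nat) (y : nat -> nat -> R) s m :
  (0 < s)%N -> trig_ext n y s%:Z m = y s m.
Proof. by case: s. Qed.

Lemma trig_ext_neg (R : comNzRingType) (n : nat) (y : nat -> nat -> R) s m :
  (1 <= s <= n)%N -> trig_ext n y (- (s%:Z - 1)) m = - y (n - s + 1)%N m.
Proof.
case: s => // s /andP[_ lesn].
have -> : s.+1%:Z - 1 = s%:Z by rewrite intS addrC addKr.
by rewrite /trig_ext oppr_gt0 abszN addn1 subnSK.
Qed.

Lemma diff_hyperbolic_exists (R : comNzRingType) (n : nat) :
  exists y : nat -> nat -> R, diff_hyperbolic n y.
Proof.
pose st (g : nat -> R) s := g s + (if s == 1%N then g n else g s.-1).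
exists (fun s m => iter m st (fun s => (s == 1%N)%:R) s).
split=> [s m|m||s].
- by case: s => [|[|s]] // _; apply/fdiffP; rewrite iterS.
- by apply/fdiffP; rewrite iterS.
- by [].
- by case: s => [|[|s]].
Qed.

Lemma diff_hyperbolic_unique (R : comNzRingType) (n : nat)
    (y z : nat -> nat -> R) :
  diff_hyperbolic n y -> diff_hyperbolic n z ->
  forall s m : nat, (1 <= s <= n)%N -> y s m = z s m.
Proof.
move=> [yS y1 y10 ys0] [zS z1 z10 zs0] s m; elim: m s => [|m IH] [|[|s]] // hs.
- by rewrite y10 z10.
- by rewrite ys0 // zs0.
- have hn : (1 <= n <= n)%N by rewrite leqnn andbT; case/andP: hs.
  have /fdiffP -> := y1 m; have /fdiffP -> := z1 m.
  by rewrite (IH 1%N hs) (IH n hn).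
- have hs' : (1 <= s.+1 <= n)%N by move: hs => /= /ltnW.
  have /fdiffP -> := yS s.+2 m hs; have /fdiffP -> := zS s.+2 m hs.
  by rewrite (IH s.+2 hs) (IH s.+1 hs').
Qed.

Lemma diff_trigonometric_exists (R : comNzRingType) (n : nat) :
  exists y : nat -> nat -> R, diff_trigonometric n y.
Proof.
pose st (g : nat -> R) s := g s + (if s == 1%N then - g n else g s.-1).
exists (fun s m => iter m st (fun s => (s == 1%N)%:R) s).
split=> [s m|m||s].
- by case: s => [|[|s]] // _; apply/fdiffP; rewrite iterS.
- by apply/fdiffP; rewrite iterS.
- by [].
- by case: s => [|[|s]].
Qed.

Lemma diff_trigonometric_unique (R : comNzRingType) (n : nat)
    (y z : nat -> nat -> R) :
  diff_trigonometric n y -> diff_trigonometric n z ->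
  forall s m : nat, (1 <= s <= n)%N -> y s m = z s m.
Proof.
move=> [yS y1 y10 ys0] [zS z1 z10 zs0] s m; elim: m s => [|m IH] [|[|s]] // hs.
- by rewrite y10 z10.
- by rewrite ys0 // zs0.
- have hn : (1 <= n <= n)%N by rewrite leqnn andbT; case/andP: hs.
  have /fdiffP -> := y1 m; have /fdiffP -> := z1 m.
  by rewrite (IH 1%N hs) (IH n hn).
- have hs' : (1 <= s.+1 <= n)%N by move: hs => /= /ltnW.
  have /fdiffP -> := yS s.+2 m hs; have /fdiffP -> := zS s.+2 m hs.
  by rewrite (IH s.+2 hs) (IH s.+1 hs').
Qed.

(* Main.v *)
Require Import Defs.
From HB Require Import structures.
From mathcomp Require Import all_boot all_order all_algebra.
From mathcomp Require Import zify.
Set Implicit Arguments.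
Unset Strict Implicit.
Unset Printing Implicit Defensive.
Import Order.TTheory GRing.Theory Num.Theory.
Local Open Scope ring_scope.

(** Both formulas are instances, at [c = 1] and [c = -1], of one statement
    about the system whose first equation is [Delta y_1 = c y_n].  In the
    algebra [R[w] / (w^n - c)] this system says that
    [y_1(m) + y_2(m) w + ... + y_n(m) w^(n-1) = (1 + w)^m], and the addition
    formula is the coefficient of [w^(i-1)] in
    [(1 + w)^(m + s) = (1 + w)^s (1 + w)^m]: a product of powers of [w] whose
    exponent exceeds [n - 1] wraps around with a factor [c], which is what the
    extension of the index to [0, -1, ..., 1 - n] records.

    The proof stays with the difference equations.  The extension is chosen
    so that [Delta y_k = y_(k-1)] holds uniformly in the extended range
    ([twisted_ext_step]).  Hence, for fixed [s], the right-hand side of the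
    formula, as a function of [m], solves the same system as
    [y_i(m + s)]; at [m = 0] both equal [y_i(s)] because the extended family
    then takes the value [1] at index [1] and [0] at the other indices from
    [2 - n] to [n] ([twisted_ext_init]).  Two solutions with equal initial values coincide,
    by induction on [m]. *)

Definition diff_twisted (R : comNzRingType) (c : R) (n : nat)
    (y : nat -> nat -> R) : Prop :=
  [/\ forall s m : nat, (2 <= s <= n)%N -> fdiff (y s) m = y s.-1 m,
      forall m : nat, fdiff (y 1%N) m = c * y n m,
      y 1%N 0%N = 1
    & forall s : nat, (2 <= s <= n)%N -> y s 0%N = 0].

Definition twisted_ext (R : comNzRingType) (c : R) (n : nat)
    (y : nat -> nat -> R) (k : int) (m : nat) : R :=
  if 0 < k then y `|k|%N m else c * y (n - `|k|)%N m.

Section TwistedSystem.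

Variables (R : comNzRingType) (c : R) (n : nat) (y : nat -> nat -> R).
Hypothesis hy : diff_twisted c n y.

(** Crossing from index [1] to index [0] is exactly the closing equation of
    the system; at nonpositive indices the equation is that of [y_(n - |k|)]
    multiplied by [c].  The index [1 - n] is excluded since it stands for
    [c y_1], whose difference is [c^2 y_n]. *)
Lemma twisted_ext_step (k : int) (m : nat) :
  1 - n%:Z < k <= n%:Z ->
  twisted_ext c n y k m.+1 = twisted_ext c n y k m + twisted_ext c n y (k - 1) m.
Proof.
have [yS y1 _ _] := hy; move=> hk; apply/fdiffP; rewrite /twisted_ext /fdiff.
have [k_gt1 | k_le1] := ltrP 1 k.
- have -> : 0 < k by lia.
  have -> : 0 < k - 1 by lia.
  have -> : `|k - 1|%N = `|k|.-1 by lia.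
  by apply: yS; lia.
have -> : (0 < k - 1) = false by lia.
have [k_gt0 | k_le0] := ltrP 0 k.
- have -> : k = 1 by lia.
  by rewrite subrr subn0; exact: y1.
rewrite -mulrBr; congr (c * _).
have -> : (n - `|(k - 1)%R|)%N = (n - `|k|).-1 by lia.
by apply: yS; lia.
Qed.

Lemma twisted_ext_init (k : int) :
  1 - n%:Z < k <= n%:Z -> twisted_ext c n y k 0 = (k == 1)%:R.
Proof.
have [_ _ y10 y0] := hy; move=> hk; rewrite /twisted_ext.
have [-> | k_neq1] := eqVneq k 1; first by rewrite y10.
by case: ifP => k_gt0; rewrite y0 ?mulr0 //; lia.
Qed.

Definition convolution (s i m : nat) : R :=
  \sum_(1 <= j < n.+1) y j s * twisted_ext c n y (i%:Z - j%:Z + 1) m.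

Lemma convolution_init (s i : nat) :
  (1 <= i <= n)%N -> convolution s i 0 = y i s.
Proof.
move=> hi; rewrite /convolution (big_rem i) ?mem_index_iota ?ltnS //=.
rewrite big_seq big1 => [|j].
  by rewrite twisted_ext_init ?subrr ?mulr1 ?addr0 //; lia.
rewrite mem_rem_uniq ?iota_uniq // inE mem_index_iota => /andP[j_neqi hj].
have -> : twisted_ext c n y (i%:Z - j%:Z + 1) 0 = 0; last by rewrite mulr0.
rewrite twisted_ext_init; last by lia.
by have -> : (i%:Z - j%:Z + 1 == 1) = false by lia.
Qed.

Lemma convolution_step (s i m : nat) : (1 <= i <= n)%N ->
  convolution s i m.+1 = convolution s i m +
    \sum_(1 <= j < n.+1) y j s * twisted_ext c n y (i%:Z - j%:Z) m.
Proof.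
move=> hi; rewrite -big_split; apply: eq_big_nat => j hj /=.
by rewrite twisted_ext_step ?addrK ?mulrDr //; lia.
Qed.

(** This makes [convolution s] satisfy the closing equation of the system:
    the sum on the left is the difference of [convolution s 1], and its
    extended indices [1 - j] are all nonpositive, so that each of its terms
    carries the factor [c]. *)
Lemma convolution_wrap (s m : nat) :
  \sum_(1 <= j < n.+1) y j s * twisted_ext c n y (1%:Z - j%:Z) m =
  c * convolution s n m.
Proof.
rewrite mulr_sumr; apply: eq_big_nat => j hj; rewrite mulrCA; congr (_ * _).
rewrite /twisted_ext.
have -> : (0 < 1%:Z - j%:Z) = false by lia.
have -> : 0 < n%:Z - j%:Z + 1 by lia.
by congr (c * y _ m); lia.
Qed.

(** The induction has to run over all [i] at once, because each step from [m]
    to [m + 1] at index [i] uses the formula at the preceding index, and at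
    [n] when [i = 1]. *)
Lemma twisted_addition (m s i : nat) :
  (1 <= i <= n)%N -> y i (m + s)%N = convolution s i m.
Proof.
have [yS y1 _ _] := hy.
elim: m i => [|m IH] i hi; first by rewrite convolution_init.
rewrite addSn convolution_step // -IH //.
have [i_gt1 | i_le1] := ltnP 1 i.
- have /fdiffP -> : fdiff (y i) (m + s) = y i.-1 (m + s)%N by apply: yS; lia.
  rewrite (IH i.-1); last by lia.
  congr (_ + _); apply: eq_big_nat => j _.
  by congr (_ * twisted_ext _ _ _ _ _); lia.
have -> : i = 1%N by lia.
have /fdiffP -> := y1 (m + s)%N.
by rewrite convolution_wrap (IH n) //; lia.
Qed.

End TwistedSystem.

Theorem theorem2 (R : comNzRingType) (n : nat) (n_gt0 : (0 < n)%N)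
    (H K : nat -> nat -> R)
    (hH : diff_hyperbolic n H) (hK : diff_trigonometric n K)
    (m s i : nat) (hi : (1 <= i <= n)%N) :
  H i (m + s)%N =
    \sum_(1 <= j < n.+1) H j s * hyp_ext n H (i%:Z - j%:Z + 1) m
  /\
  K i (m + s)%N =
    \sum_(1 <= j < n.+1) K j s * trig_ext n K (i%:Z - j%:Z + 1) m.
Proof.
split.
- have hH1 : diff_twisted 1 n H.
    by case: hH => HS H1 H10 H0; split=> // k; rewrite mul1r.
  rewrite (twisted_addition hH1) //; apply: eq_bigr => j _.
  by rewrite /twisted_ext mul1r.
have hK1 : diff_twisted (-1) n K.
  by case: hK => KS K1 K10 K0; split=> // k; rewrite mulN1r.
rewrite (twisted_addition hK1) //; apply: eq_bigr => j _.
by rewrite /twisted_ext mulN1r.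
Qed.
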